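(* Fix $n,p\in\mathbb N$, $\alpha>0$ and a convex set $\mathcal W\subseteq\mathcal W_p$. Let $\Lambda:\mathcal W\to\mathbb R$ be differentiable of some order $m$ in the sense below. If $\Lambda$ is not constant on $\mathcal W$, then there exist constants $c,C>0$ depending only on $\Lambda$ and $\mathcal W$ such that $$\inf_{Q\in\mathcal Q_\alpha}\inf_{\hat\Lambda_n}\sup_{f\in\mathcal W}\mathbb E_{QP_f}\big[|\hat\Lambda_n-\Lambda(f)|\big]\ \ge\ c\,\big(n(e^\alpha-1)^2\big)^{-1/2}$$ whenever $n(e^\alpha-1)^2\ge C$. Here the second infimum runs over all measurable functions $\hat\Lambda_n$ of the sanitized data $Z_1,\dots,Z_n$ drawn i.i.d. from $QP_f$.
   Context: Fix a constant $M>0$. For a vector $\lambda=(\lambda_0,\dots,\lambda_p)$ of finite measures on $[0,1]$ and $1\le q<\infty$, set $\|f\|_{(q,p,\lambda)}=\sum_{j=0}^p\big(\int_0^1|f^{(j)}|^q\,d\lambda_j\big)^{1/q}$; for $q=\infty$ the integrals are replaced by essential suprema. Write $\|f\|_{(q,p)}$ when every $\lambda_j$ is Lebesgue measure. Put $\mathcal W_p=\{f\in C^p[0,1]: f\ge0,\ \int_0^1 f=1,\ \|f\|_{(\infty,p)}<M\}$. The data $X_1,\dots,X_n$ are i.i.d. with density $f$ on $[0,1]$ and law $P_f$. Local differential privacy: for $\alpha>0$, $\mathcal Q_\alpha$ is the set of all Markov kernels $Q$ from $([0,1],\mathcal B[0,1])$ to a measurable space $(\mathcal Z,\mathcal G)$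 such that $Q(A\mid x)\le e^\alpha Q(A\mid x')$ for all $A\in\mathcal G$ and all $x,x'\in[0,1]$. Each $Z_i\sim Q(\cdot\mid X_i)$ is drawn independently, so $Z_1,\dots,Z_n$ are i.i.d. with law $QP_f=\int Q(\cdot\mid x)P_f(dx)$. Differentiable functional: $\Lambda$, defined on $\mathcal W\subseteq\mathcal W_p$, is differentiable of order $m$ ($0\le m<p$) if the following hold. There is a vector $\lambda$ of finite measures not depending on $f$. For each $f\in\mathcal W$ there is a bounded linear functional $T_f$ on $C^p[0,1]$ with $\Lambda(f+h)=\Lambda(f)+T_f(h)+O(\|h\|^2_{(2,m,\lambda)})$ for all $h\in C^p[0,1]$ with $f+h$ in the domain and $\|h\|_{(\infty,m)}$ small enough. *)

(* Defs.v *)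
From HB Require Import structures.
From mathcomp Require Import all_boot all_order all_algebra.
From mathcomp Require Import all_classical all_reals all_analysis.

Set Implicit Arguments.
Unset Strict Implicit.
Unset Printing Implicit Defensive.

Import Order.TTheory GRing.Theory Num.Theory.
Import numFieldNormedType.Exports.

Local Open Scope classical_set_scope.
Local Open Scope ring_scope.

Section LDPDefs.
Variable R : realType.
Local Notation RT := (measurableTypeR R).

Definition I01 : set RT := `[0%R, 1%R].
Lemma measurable_I01 : measurable I01.
Proof. exact: measurable_itv. Qed.

Definition leb01 := mrestr (@lebesgue_measure R) measurable_I01.

(* f ∈ C^p[0,1]: f continuous on [0,1]; the derivatives f^(j), j < p, exist on
   ]0,1[, and every f^(j), j <= p, extends continuously to [0,1].
   Only the values of f on [0,1] matter. *)
Definition Cp (p : nat) (f : R -> R) : Prop :=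
  {within `[0%R, 1%R], continuous f} /\
  (forall j : nat, (j < p)%N ->
     forall x : R, x \in `]0%R, 1%R[ -> derivable (derive1n j f) x 1) /\
  (forall j : nat, (j <= p)%N ->
     exists g : R -> R, {within `[0%R, 1%R], continuous g} /\
       forall x : R, x \in `]0%R, 1%R[ -> g x = derive1n j f x).

Definition Dj (j : nat) (f : R -> R) (x : R) : R :=
  if x == 0 then lim (derive1n j f y @[y --> 0^'+])
  else if x == 1 then lim (derive1n j f y @[y --> 1^'-])
  else derive1n j f x.

Definition normqp (lam : nat -> {measure set RT -> \bar R}) (q : \bar R)
    (p : nat) (f : RT -> R) : \bar R :=
  (\sum_(j < p.+1) 'N[mrestr (lam j) measurable_I01]_q [EFin \o Dj j f])%E.

Definition normLeb (q : \bar R) (p : nat) (f : R -> R) : \bar R :=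
  normqp (fun _ => @lebesgue_measure R) q p f.

Definition Wp (M : R) (p : nat) (f : R -> R) : Prop :=
  [/\ Cp p f,
      (forall x, x \in `[0%R, 1%R] -> 0 <= f x),
      (\int[@lebesgue_measure R]_(x in I01) (f x)%:E = 1)%E
    & (normLeb +oo%E p f < M%:E)%E].

Definition convex_fset (W : set (R -> R)) : Prop :=
  forall f g t, W f -> W g -> 0 <= t <= 1 ->
    W (fun x => t * f x + (1 - t) * g x).

Definition differentiable_functional (p : nat) (W : set (R -> R))
    (Lam : (R -> R) -> R) (m : nat) : Prop :=
  (m < p)%N /\
  exists lam : nat -> {finite_measure set RT -> \bar R},
  forall f, W f ->
  exists T : (R -> R) -> R,
    (forall (a b : R) (g h : R -> R), Cp p g -> Cp p h ->
        T (fun x => a * g x + b * h x) = a * T g + b * T h) /\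
    (exists K : R, forall h, Cp p h ->
        (`|T h|%:E <= K%:E * normLeb +oo%E p h)%E) /\
    (exists (K delta : R), 0 < delta /\
      forall h, Cp p h -> W (fun x => f x + h x) ->
        (normLeb +oo%E m h < delta%:E)%E ->
        (`|Lam (fun x => f x + h x) - Lam f - T h|%:E <=
           K%:E * (normqp (fun j => lam j) 2%:E m h *
                   normqp (fun j => lam j) 2%:E m h))%E).

Definition LDP d (Z : measurableType d) (alpha : R) (Q : R.-pker RT ~> Z) : Prop :=
  forall A : set Z, measurable A ->
  forall x x' : R, x \in `[0%R, 1%R] -> x' \in `[0%R, 1%R] ->
    (Q x A <= (expR alpha)%:E * Q x' A)%E.

Definition QPf d (Z : measurableType d) (Q : R.-pker RT ~> Z) (f : R -> R)
    (A : set Z) : \bar R :=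
  (\int[@lebesgue_measure R]_(x in I01) ((f x)%:E * Q x A))%E.

Definition is_nfold_product d (Z : measurableType d) (n : nat)
    (Pn : probability (n.-tuple Z) R) (mu : set Z -> \bar R) : Prop :=
  forall A : 'I_n -> set Z, (forall i, measurable (A i)) ->
    Pn [set t | forall i, A i (tnth t i)] = (\prod_(i < n) mu (A i))%E.

End LDPDefs.

(* Main.v *)
Require Import Defs.
From HB Require Import structures.
From mathcomp Require Import all_boot all_order all_algebra.
From mathcomp Require Import all_classical all_reals all_analysis.
From mathcomp Require Import measurable_realfun ess_sup_inf lra ring.
Import Order.TTheory GRing.Theory Num.Theory.
Import numFieldNormedType.Exports.
Local Open Scope classical_set_scope.
Local Open Scope ring_scope.

(** Along the segment [t |-> f + t (g - f)] of [W] with [Lam f <> Lam g], the functional is differentiable in [t], so by the mean value theorem it moves at a linear rate near some interior point [f_t]. Le Cam's two-point method is applied to [f_t] and [f_(t+s)] with [s] of order [(n (e^alpha - 1)^2)^(-1/2)].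

Privacy gives [|QP_(t+s) - QP_t| <= e QP_t] as measures, with [e = (e^alpha - 1) s ||g - f||]. Hence [QP_t] and [QP_(t+s)] are the images, under one common channel from [bool] to [Z], of a fair coin and of a coin of bias [e], and the product laws are no further apart than those of [n] tosses of these coins. This replaces densities of the sanitized data and reduces the information bound to a finite sum: the chi-square distance [(1 + e^2)^n - 1]. *)

(** * Product laws on tuples *)

(** Convertible to the set in [is_nfold_product], whose hypotheses therefore apply to [rect A] as
    they stand. *)
Definition rect {T : Type} {n : nat} (A : 'I_n -> set T) : set (n.-tuple T) :=
  [set t | forall i, A i (tnth t i)].

Lemma rect_cons (T : Type) n (A : 'I_n.+1 -> set T) :
  (fun z : T * n.-tuple T => [tuple of z.1 :: z.2]) @^-1` rect A =
  A ord0 `*` rect (fun i => A (lift ord0 i)).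
Proof.
apply/seteqP; split=> [[x t] /= At|[x t] [/= Ax At]].
- split=> /= [|i]; first exact: (At ord0).
  by have := At (lift ord0 i); rewrite tnthS.
- move=> i; have [j ->|->] := unliftP ord0 i; last exact: Ax.
  by rewrite tnthS; exact: At.
Qed.

Lemma rectI (T : Type) n (A B : 'I_n -> set T) :
  rect A `&` rect B = rect (fun i => A i `&` B i).
Proof.
apply/seteqP; split=> [t [At Bt] i|t ABt]; first by split; [exact: At|exact: Bt].
by split=> i; have [] := ABt i.
Qed.

Section tuple_product.
Context d (Z : measurableType d) (R : realType).

Lemma measurable_rect n (A : 'I_n -> set Z) :
  (forall i, measurable (A i)) -> measurable (rect A).
Proof.
move=> mA.
have -> : rect A = \bigcap_(i in [set` enum 'I_n]) ((@tnth n Z)^~ i @^-1` A i).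
  apply/seteqP; split=> [t At i _|t At i]; first exact: At.
  by apply: At; rewrite /= mem_enum.
apply: fin_bigcap_measurable; first exact: finite_seq.
by move=> i _; rewrite -[X in measurable X]setTI; exact: measurable_tnth.
Qed.

(** A coordinate preimage is a rectangle whose other sides are [setT]. Rectangles are preferred as
    generators because they are stable under intersection, as the Dynkin argument below requires. *)
Lemma measurable_rectE n :
  (@measurable _ (n.-tuple Z)) =
  <<s [set X | exists2 A : 'I_n -> set Z, (forall i, measurable (A i)) & X = rect A] >>.
Proof.
apply/seteqP; split; last first.
  apply: smallest_sub; first exact: sigma_algebra_measurable.
  by move=> _ [A mA ->]; exact: measurable_rect.
apply: smallest_sub; first exact: smallest_sigma_algebra.
rewrite -bigcup_seq => X [i /= _ [Y mY <-]].
apply: sub_sigma_algebra; exists (fun j => if j == i then Y else setT).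
  by move=> j; case: ifP.
rewrite setTI; apply/seteqP; split=> [t Yt j|t /(_ i)]; last by rewrite eqxx.
by case: eqP => // ->.
Qed.

(** The factors may differ, since each sequence of coin outcomes yields its own product law. The
    induction pushes a binary product forward along cons. *)
Lemma tuple_product_exists n (P : 'I_n -> probability Z R) :
  exists Pn : probability (n.-tuple Z) R,
  forall A : 'I_n -> set Z, (forall i, measurable (A i)) ->
    Pn (rect A) = (\prod_(i < n) P i (A i))%E.
Proof.
elim: n P => [|n IH] P.
  exists (\d_([tuple] : 0.-tuple Z)) => A mA; rewrite big_ord0 /= diracE mem_set//.
  by move=> [].
have [Q QE] := IH (fun i => P (lift ord0 i)).
pose c := fun z : Z * n.-tuple Z => [tuple of z.1 :: z.2].
have mc : measurable_fun setT c by apply: measurable_cons.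
pose PQ : probability _ _ := (P ord0 \x Q)%E.
pose c' := mfun_Sub (mem_set mc).
exists (distribution PQ c') => A mA.
rewrite /distribution /pushforward /= rect_cons product_measure1E//; last exact: measurable_rect.
rewrite big_ord_recl; congr (_ * _)%E.
exact: (QE _ (fun i => mA (lift ord0 i))).
Qed.

(** Dynkin's pi-lambda theorem. It is needed because [is_nfold_product] describes a law on
    rectangles only. *)
Lemma mixture_rect n (I : finType) (w : I -> R) (Q : I -> probability (n.-tuple Z) R)
    (P : probability (n.-tuple Z) R) :
  (forall i, 0 <= w i) ->
  (forall A : 'I_n -> set Z, (forall i, measurable (A i)) ->
    P (rect A) = (\sum_i (w i)%:E * Q i (rect A))%E) ->
  forall A, measurable A -> P A = (\sum_i (w i)%:E * Q i A)%E.
Proof.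
move=> w0 PQ A mA.
(* The weights are not assumed to sum to 1; stability under complements uses this identity on the
   whole space instead. *)
have PT : P setT = (\sum_i (w i)%:E * Q i setT)%E.
  have -> : [set: n.-tuple Z] = rect (fun=> setT) by apply/seteqP; split.
  exact: PQ.
move: (mA); rewrite measurable_rectE.
apply: (dynkin_induction (P := [set A | P A = (\sum_i (w i)%:E * Q i A)%E])
  (measurable_rectE n)) => //.
- move=> _ _ [X mX ->] [Y mY ->]; exists (fun i => X i `&` Y i); last exact: rectI.
  by move=> i; exact: measurableI.
- by move=> _ [X mX ->]; exact: PQ.
- move=> S mS /= PS; rewrite probability_setC// -(probability_setT P) PT PS -sumeN; last first.
    by move=> i j _ _; rewrite fin_num_adde_defl// fin_numM// fin_num_measure.
  rewrite -big_split/=; apply: eq_bigr => i _.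
  by rewrite probability_setC// probability_setT muleBr// fin_num_adde_defr// fin_num_measure.
- move=> F mF tF /= PF.
  have mUF : measurable (\bigcup_k F k) by exact: bigcupT_measurable.
  rewrite (measure_semi_bigcup _ mF tF mUF) (eq_eseriesr (fun k _ => PF k)).
  rewrite nneseries_sum; last by move=> *; rewrite mule_ge0// lee_fin.
  apply: eq_bigr => i _; rewrite nneseriesZl//.
  by rewrite (measure_semi_bigcup _ mF tF mUF).
Qed.

End tuple_product.

(** * Coin tosses and total variation *)

(** With [true] and [false] read as +1 and -1, this is the law of mean [e]; [e = 0] is the fair
    coin. *)
Definition coin {R : realType} (e : R) (b : bool) : R :=
  (1 + (if b then e else - e)) / 2.

Section coins.
Context (R : realType).
Implicit Types e : R.

Lemma coin_ge0 e b : `|e| <= 1 -> 0 <= coin e b.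
Proof. by rewrite ler_norml /coin; case: b => e1; lra. Qed.

Lemma coin_sum e n : \sum_(f : {ffun 'I_n -> bool}) \prod_i coin e (f i) = 1.
Proof.
rewrite -(bigA_distr_bigA (fun=> coin e)) big1// => i _.
by rewrite big_bool /coin /=; lra.
Qed.

(** Dividing by the fair weight 1/2 gives the factor 2, so this is 1 plus the chi-square distance of
    [n] biased tosses from [n] fair ones. *)
Lemma coin_sum_sqr e n :
  \sum_(f : {ffun 'I_n -> bool}) \prod_i (2 * coin e (f i) ^+ 2) = (1 + e ^+ 2) ^+ n.
Proof.
rewrite -(bigA_distr_bigA (fun _ b => 2 * coin e b ^+ 2)).
under eq_bigr do rewrite big_bool /coin /=.
by rewrite prodr_const card_ord; congr (_ ^+ _); field.
Qed.

(** With x = ne, the power is at most exp x, and exp(-x) >= 1 - x >= 7/8 gives exp x <= 8/7. *)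
Lemma one_add_expr_le e n : 0 <= e -> n%:R * e <= 8^-1 -> (1 + e) ^+ n <= 5 / 4.
Proof.
move=> e0 ne.
have le_exp : (1 + e) ^+ n <= expR (n%:R * e).
  rewrite expRM_natl lerXn2r// ?nnegrE ?expR_ge0// ?expR_ge1Dx//; lra.
apply: (le_trans le_exp).
have := expR_ge1Dx (- (n%:R * e)); rewrite expRN => h.
have x0 := expR_gt0 (n%:R * e).
have : 7 / 8 <= (expR (n%:R * e))^-1 by lra.
rewrite -[leLHS]invrK lef_pV2 ?posrE ?invr_gt0//; lra.
Qed.

(* Cauchy-Schwarz in the AM-GM form |a| <= a^2 / u + u / 4, with u = 2^-n: the first terms add up to the chi-square distance (1 + e^2)^n - 1. *)
Lemma coin_tv e n : n%:R * e ^+ 2 <= 8^-1 ->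
  \sum_(f : {ffun 'I_n -> bool}) `|\prod_i coin e (f i) - \prod_i coin 0 (f i)|
    <= 2^-1.
Proof.
move=> ne; pose u : R := 2^-1 ^+ n.
have u0 : 0 < u by rewrite exprn_gt0.
have uE (f : {ffun 'I_n -> bool}) : \prod_i coin 0 (f i) = u.
  rewrite (eq_bigr (fun=> 2^-1)) ?prodr_const ?card_ord// => i _.
  by rewrite /coin oppr0 if_same addr0 mul1r.
have su : \sum_(f : {ffun 'I_n -> bool}) u = 1.
  by rewrite -(coin_sum 0 n); apply: eq_bigr => f _; rewrite uE.
have amgm (a : R) : `|a - u| <= a ^+ 2 / u - 2 * a + u + u / 4.
  have -> : a ^+ 2 / u - 2 * a + u = (a - u) ^+ 2 / u by field; lra.
  rewrite -subr_ge0.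
  have -> : (a - u) ^+ 2 / u + u / 4 - `|a - u| = (`|a - u| - u / 2) ^+ 2 / u.
    by rewrite -(real_normK (num_real (a - u))); field; lra.
  by rewrite divr_ge0 ?sqr_ge0// ltW.
apply: (@le_trans _ _ (\sum_(f : {ffun 'I_n -> bool})
    ((\prod_i coin e (f i)) ^+ 2 / u - 2 * \prod_i coin e (f i) + u + u / 4))).
  by apply: ler_sum => f _; rewrite uE; exact: amgm.
rewrite 2!big_split/= big_split/= sumrN -mulr_sumr coin_sum su.
have -> : \sum_(f : {ffun 'I_n -> bool}) ((\prod_i coin e (f i)) ^+ 2 / u) =
    (1 + e ^+ 2) ^+ n.
  rewrite -coin_sum_sqr; apply: eq_bigr => f _.
  rewrite [RHS]big_split/= prodr_const card_ord prodrXl mulrC /u; congr (_ * _).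
  by rewrite exprVn invrK.
(* The total is (1 + e^2)^n - 2 + 1 + 1/4, at most 5/4 - 3/4 = 1/2. *)
by rewrite -mulr_suml su; have := one_add_expr_le _ _ (sqr_ge0 e) ne; lra.
Qed.

End coins.

Section product_tv.
Context d (Z : measurableType d) (R : realType).

(** Expanding the product of two-term sums yields one term per outcome sequence. The family [Q] is
    chosen before [e] and [P], so that one channel serves both hypotheses. *)
Lemma product_mixture (nu : bool -> probability Z R) n :
  exists Q : {ffun 'I_n -> bool} -> probability (n.-tuple Z) R,
  forall (e : R) (P : probability (n.-tuple Z) R), `|e| <= 1 ->
  (forall A : 'I_n -> set Z, (forall i, measurable (A i)) ->
     P (rect A) = (\prod_(i < n) ((coin e true)%:E * nu true (A i) +
                                  (coin e false)%:E * nu false (A i)))%E) ->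
  forall A, measurable A ->
    P A = (\sum_(f : {ffun 'I_n -> bool}) (\prod_i coin e (f i))%:E * Q f A)%E.
Proof.
pose prop (f : {ffun 'I_n -> bool}) (Q : probability (n.-tuple Z) R) :=
  forall A : 'I_n -> set Z, (forall i, measurable (A i)) ->
    Q (rect A) = (\prod_(i < n) nu (f i) (A i))%E.
have [Q QE] := choice
  (fun f : {ffun 'I_n -> bool} => tuple_product_exists _ _ _ _ (fun i => nu (f i)) : exists Q, prop f Q).
exists Q => e P e1 PE; apply: mixture_rect.
  by move=> f; apply: prodr_ge0 => i _; exact: coin_ge0.
move=> A mA; rewrite PE//.
pose F i b := coin e b * fine (nu b (A i)).
rewrite (eq_bigr (fun i => (\sum_b F i b)%:E)); last first.
  move=> i _; rewrite big_bool /F EFinD !EFinM !fineK//; exact: fin_num_measure.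
rewrite prodEFin bigA_distr_bigA -sumEFin; apply: eq_bigr => f _.
rewrite QE// /F big_split/= EFinM; congr (_ * _)%E.
rewrite -prodEFin; apply: eq_bigr => i _; rewrite fineK//; exact: fin_num_measure.
Qed.

(** Data processing: both laws mix the same [Q f], and each [Q f A] lies in [0, 1], so the laws
    differ on [A] by at most the l1 distance of the coin weights. *)
Lemma product_tv (nu : bool -> probability Z R) n (e : R)
    (P0 P1 : probability (n.-tuple Z) R) :
  `|e| <= 1 -> n%:R * e ^+ 2 <= 8^-1 ->
  (forall A : 'I_n -> set Z, (forall i, measurable (A i)) ->
     P0 (rect A) = (\prod_(i < n) ((coin e true)%:E * nu true (A i) +
                                  (coin e false)%:E * nu false (A i)))%E) ->
  (forall A : 'I_n -> set Z, (forall i, measurable (A i)) ->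
     P1 (rect A) = (\prod_(i < n) ((coin 0 true)%:E * nu true (A i) +
                                  (coin 0 false)%:E * nu false (A i)))%E) ->
  forall A, measurable A -> `|fine (P0 A) - fine (P1 A)| <= 2^-1.
Proof.
move=> e1 ne P0E P1E A mA; have [Q QE] := product_mixture nu n.
rewrite (QE e P0)// (QE 0 P1) ?normr0//.
have fineQ (a : R) : fine (\sum_(f : {ffun 'I_n -> bool}) (\prod_i coin a (f i))%:E * Q f A)%E =
    \sum_(f : {ffun 'I_n -> bool}) \prod_i coin a (f i) * fine (Q f A).
  rewrite -[RHS]/(fine (_%:E)) -sumEFin; congr fine; apply: eq_bigr => f _.
  by rewrite EFinM fineK//; exact: fin_num_measure.
rewrite !fineQ -sumrB; apply: le_trans (ler_norm_sum _ _ _) _.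
apply: le_trans (coin_tv _ _ _ ne); apply: ler_sum => f _.
rewrite -mulrBl normrM ler_piMr// ger0_norm ?fine_ge0//.
by rewrite -lee_fin fineK ?probability_le1//; exact: fin_num_measure.
Qed.

End product_tv.

(** * Two-point lower bound and private channels *)

Section le_cam.
Context d (T : measurableType d) (R : realType).

(** A form of Markov's inequality. *)
Lemma integral_ge_cstM (P : probability T R) (f : T -> R) (c : R) (A : set T) :
  measurable A -> measurable_fun setT f -> (forall t, 0 <= f t) ->
  (forall t, A t -> c <= f t) -> 0 <= c ->
  ((c * fine (P A))%:E <= \int[P]_t (f t)%:E)%E.
Proof.
move=> mA mf f0 cf c0.
rewrite EFinM fineK; last exact: fin_num_measure.
rewrite -integral_cst//.
have /measurable_EFinP mEf := mf.
apply: (@le_trans _ _ (\int[P]_(t in A) (f t)%:E)%E).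
  by apply: ge0_le_integral => //; exact: measurable_funTS.
by apply: ge0_subset_integral => //= t _; rewrite lee_fin.
Qed.

(** Le Cam's argument: on [A] the estimator misses [L0] by at least D/2, and off [A] it misses [L1]
    by at least D/2, by the triangle inequality. *)
Lemma two_point_lower_bound (P0 P1 : probability T R) (est : T -> R) (L0 L1 : R) :
  measurable_fun setT est ->
  (forall A, measurable A -> `|fine (P0 A) - fine (P1 A)| <= 2^-1) ->
  ((`|L0 - L1| / 8)%:E <= \int[P0]_t (`|est t - L0|)%:E)%E \/
  ((`|L0 - L1| / 8)%:E <= \int[P1]_t (`|est t - L1|)%:E)%E.
Proof.
move=> mest tv.
have md (L : R) : measurable_fun setT (fun t => `|est t - L|).
  by apply: measurableT_comp => //; exact: measurable_funB.
pose D := `|L0 - L1|; have D0 : 0 <= D by exact: normr_ge0.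
pose A := [set t | D / 2 <= `|est t - L0|].
have mA : measurable A.
  rewrite /A (_ : [set _ | _] = (fun t => `|est t - L0|) @^-1` `[D / 2, +oo[).
    by rewrite -[X in measurable X]setTI; apply: md => //; exact: measurable_itv.
  by apply/seteqP; split=> t /=; rewrite in_itv/= andbT.
have D20 : 0 <= D / 2 by rewrite divr_ge0.
have b0 := integral_ge_cstM P0 _ (D / 2) A mA (md L0) (fun=> normr_ge0 _) (fun t At => At) D20.
have nA t : (~` A) t -> D / 2 <= `|est t - L1|.
  move=> /negP; rewrite -ltNge /D => h.
  have : `|L0 - L1| <= `|est t - L0| + `|est t - L1|.
    rewrite -(normrN (est t - L0)) opprB; apply: le_trans (ler_normD _ _).
    by rewrite addrA subrK.
  lra.
have b1 := integral_ge_cstM P1 _ (D / 2) _ (measurableC mA) (md L1) (fun=> normr_ge0 _) nA D20.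
(* If P0(A) < 1/4, then P1(A) < 3/4, so the complement has P1-mass at least 1/4. Either way the risk
   is at least (D/2)(1/4). *)
have [p0|p0] := leP (4^-1) (fine (P0 A)); [left|right].
  by apply: le_trans b0; rewrite lee_fin -/D; nra.
apply: le_trans b1; rewrite lee_fin -/D.
have := tv A mA; rewrite ler_norml probability_setC// => /andP[h _].
have : fine (1 - P1 A) = 1 - fine (P1 A).
  by rewrite fineB//; exact: fin_num_measure.
move=> ->; nra.
Qed.

End le_cam.

(** * Images of signed densities under a private kernel *)

Section private_channel.
Context (R : realType) d (Z : measurableType d).
Local Notation RT := (measurableTypeR R).
Local Notation mu := (@lebesgue_measure R).
Variable Q : R.-pker RT ~> Z.
Implicit Types (w : R -> R) (A : set Z).

Local Notation cont w := ({within `[0%R, 1%R], continuous w}).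

Lemma lebesgue_I01 : mu (@I01 R) = 1%E.
Proof. by rewrite /I01 lebesgue_measure_itv/= lte_fin ltr01 EFinN sube0. Qed.

Lemma cont_integrable w : cont w -> mu.-integrable (@I01 R) (EFin \o w).
Proof. by move=> cw; apply: continuous_compact_integrable => //; exact: segment_compact. Qed.

Lemma kernel_le1 x A : measurable A -> (Q x A <= 1)%E.
Proof. by move=> mA; rewrite -(prob_kernel (s := Q) x) le_measure ?inE. Qed.

Lemma kernel_fin_num x A : measurable A -> Q x A \is a fin_num.
Proof.
by move=> mA; rewrite ge0_fin_numE// (le_lt_trans (kernel_le1 x A mA)) ?ltry.
Qed.

Lemma integrable_mul_kernel w A : measurable A -> cont w ->
  mu.-integrable (@I01 R) (fun x => (w x)%:E * Q x A)%E.
Proof.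
move=> mA cw; have iw := cont_integrable w cw.
apply: le_integrable iw; first exact: measurable_I01.
  apply: emeasurable_funM; first by case/integrableP: (cont_integrable w cw).
  exact: measurable_funTS (measurable_kernel Q A mA).
move=> x _; rewrite abseM [leRHS]/= -[leRHS]mule1.
by rewrite lee_pmul// gee0_abs// kernel_le1.
Qed.

Lemma QPf_fin_num w A : measurable A -> cont w -> QPf Q w A \is a fin_num.
Proof.
move=> mA cw; apply: integrable_fin_num; first exact: measurable_I01.
exact: integrable_mul_kernel.
Qed.

Lemma QPf_linear w1 w2 (a b : R) A : measurable A -> cont w1 -> cont w2 ->
  QPf Q (fun x => a * w1 x + b * w2 x) A = (a%:E * QPf Q w1 A + b%:E * QPf Q w2 A)%E.
Proof.
move=> mA c1 c2; rewrite /QPf -!integralZl//; do ?exact: integrable_mul_kernel; do ?exact: measurable_I01.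
rewrite -integralD//; do ?(apply: integrableZl); do ?exact: integrable_mul_kernel; do ?exact: measurable_I01.
apply: eq_integral => x _.
by rewrite -(fineK (kernel_fin_num x A mA)) -!EFinM -EFinD mulrDl !mulrA.
Qed.

(** Since [w] may change sign, monotone convergence is replaced by dominated convergence with bound
    |w|. *)
Lemma QPf_semi_sigma_additive w : cont w -> semi_sigma_additive (QPf Q w).
Proof.
move=> cw F mF tF mUF.
have iF n : mu.-integrable (@I01 R) (fun x => (w x)%:E * Q x (F n))%E.
  exact: integrable_mul_kernel.
have mw : measurable_fun (@I01 R) (EFin \o w) by case/integrableP: (cont_integrable w cw).
have mI := @measurable_I01 R.
rewrite [X in X @ _ --> _](_ : _ = fun n =>
    (\int[mu]_(x in @I01 R) ((w x)%:E * Q x (\big[setU/set0]_(i < n) F i)))%E); last first.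
  apply/funext => n; rewrite /QPf big_mkord.
  rewrite -integral_sum//; apply: eq_integral => x _.
  rewrite measure_bigsetU//.
  rewrite [in RHS](eq_bigr (fun k : 'I_n => (fine (Q x (F k)))%:E)); last first.
    by move=> k _; rewrite fineK// kernel_fin_num.
  rewrite sumEFin -EFinM mulr_sumr -sumEFin; apply: eq_bigr => k _.
  by rewrite EFinM fineK// kernel_fin_num.
have mFn n : measurable (\big[setU/set0]_(i < n) F i) by exact: bigsetU_measurable.
have mQ A : measurable A -> measurable_fun (@I01 R) (fun x => (w x)%:E * Q x A)%E.
  move=> mA; apply: emeasurable_funM => //.
  exact: measurable_funTS (measurable_kernel Q A mA).
have cvgQ : {ae mu, forall x, (@I01 R) x ->
    (fun n => (w x)%:E * Q x (\big[setU/set0]_(i < n) F i))%E @ \oo -->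
    ((w x)%:E * Q x (\bigcup_i F i))%E}.
  apply: aeW => x _; apply: cvgeZl => //.
  have := @measure_semi_sigma_additive _ _ _ (Q x) F mF tF mUF.
  by under eq_fun do rewrite big_mkord -measure_bigsetU//.
have domQ : {ae mu, forall x n, (@I01 R) x ->
    (`|(w x)%:E * Q x (\big[setU/set0]_(i < n) F i)| <= `|(w x)%:E|)%E}.
  apply: aeW => x n _; rewrite abseM -[leRHS]mule1.
  by rewrite lee_pmul// gee0_abs// kernel_le1.
have iw : mu.-integrable (@I01 R) (fun x => `|(w x)%:E|%E).
  by apply: integrable_abse; exact: cont_integrable.
by have [] := dominated_convergence mI (fun n => mQ _ (mFn n)) (mQ _ mUF) cvgQ iw domQ.
Qed.

Lemma QPf_setT w : QPf Q w setT = (\int[mu]_(x in @I01 R) (w x)%:E)%E.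
Proof. by apply: eq_integral => x _; rewrite prob_kernel mule1. Qed.

(** Nonnegativity is asked of the image under [Q] and not of [w], which will be a signed density. *)
Lemma QPf_probability w : cont w ->
  (\int[mu]_(x in @I01 R) (w x)%:E = 1)%E ->
  (forall A, measurable A -> (0 <= QPf Q w A)%E) ->
  exists P : probability Z R, forall A, measurable A -> P A = QPf Q w A.
Proof.
move=> cw w1 w0.
(* A measure has to be nonnegative on nonmeasurable sets too. *)
pose m A := `|QPf Q w A|%E.
have mE A : measurable A -> m A = QPf Q w A by move=> mA; rewrite /m gee0_abs// w0.
have m0 : m set0 = 0%E.
  by rewrite /m /QPf integral0_eq ?abse0// => x _; rewrite measure0 mule0.
have m_ge0 A : (0 <= m A)%E by exact: abse_ge0.
have msig : semi_sigma_additive m.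
  move=> F mF tF mUF; rewrite mE//.
  under eq_fun do under eq_bigr do rewrite mE//.
  exact: QPf_semi_sigma_additive.
pose M := isMeasure.Build _ Z R m m0 m_ge0 msig.
pose mm : {measure set Z -> \bar R} := HB.pack m M.
have mT : mm setT = 1%E by rewrite /= mE// QPf_setT.
pose P : probability Z R := HB.pack m M (Measure_isProbability.Build _ Z R mm mT).
by exists P => A mA; exact: mE.
Qed.

(* Since g has integral 0, Q(A|x) may be recentred at any Q(A|x'), from which it differs by at most (e^alpha - 1) Q(A|x'). *)
Lemma LDP_contraction (alpha k : R) (f g : R -> R) A : LDP alpha Q -> 0 < alpha ->
  measurable A -> cont f -> cont g ->
  (forall x, x \in `[0, 1] -> 0 <= f x) ->
  (\int[mu]_(x in @I01 R) (f x)%:E = 1)%E ->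
  (\int[mu]_(x in @I01 R) (g x)%:E = 0)%E ->
  (forall x, x \in `[0, 1] -> `|g x| <= k) ->
  (`|QPf Q g A| <= ((expR alpha - 1) * k)%:E * QPf Q f A)%E.
Proof.
move=> ldp a0 mA cf cg f0 f1 g0 gk.
have mI := @measurable_I01 R.
have I01_fin : fine (mu (@I01 R)) = 1 by rewrite lebesgue_I01.
pose q x := fine (Q x A).
have qE x : Q x A = (q x)%:E by rewrite fineK// kernel_fin_num.
have q0 x : 0 <= q x by exact: fine_ge0.
have k0 : 0 <= k by apply: le_trans (gk 0 _); rewrite // in_itv/= lexx ler01.
have e1 : 1 < expR alpha by rewrite expR_gt1.
have ldpq x x' : x \in `[0, 1] -> x' \in `[0, 1] -> q x <= expR alpha * q x'.
  by move=> xI x'I; have := ldp A mA x x' xI x'I; rewrite !qE -EFinM lee_fin.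
have qq x x' : x \in `[0, 1] -> x' \in `[0, 1] ->
    `|q x - q x'| <= (expR alpha - 1) * q x'.
  (* The lower half rests on e^(-alpha) >= 2 - e^alpha. *)
  move=> xI x'I; have h1 := ldpq _ _ xI x'I; have h2 := ldpq _ _ x'I xI.
  have := q0 x'; have := q0 x; rewrite ler_norml => ? ?; apply/andP; split; nra.
have iq w : cont w -> mu.-integrable (@I01 R) (EFin \o (fun x => w x * q x)).
  move=> cw; apply: eq_integrable (integrable_mul_kernel w A mA cw) => //.
  by move=> x _; rewrite qE.
have ic w : cont w -> mu.-integrable (@I01 R) (EFin \o w) by exact: cont_integrable.
have icst (c : R) : mu.-integrable (@I01 R) (EFin \o (fun=> c)).
  by apply: ic => x; exact: cvg_cst.
have QPfE w : cont w -> QPf Q w A = (\int[mu]_(x in @I01 R) (w x * q x))%:E.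
  move=> cw; rewrite -[LHS]fineK ?QPf_fin_num// /QPf /Rintegral.
  by congr (fine _)%:E; apply: eq_integral => x _; rewrite qE.
rewrite !QPfE// -EFinM lee_fin.
set J := `|_|; pose K := (expR alpha - 1) * k.
have Jle x' : x' \in `[0, 1] -> J <= K * q x'.
  move=> x'I.
  have -> : J = `|\int[mu]_(x in @I01 R) (g x * (q x - q x'))|.
    rewrite /J; congr `|_|.
    under [RHS]eq_Rintegral do rewrite mulrBr.
    rewrite RintegralB//; [|exact: iq|exact: integrableZr (ic g cg)].
    rewrite RintegralZr//; last exact: ic.
    by rewrite {3}/Rintegral g0 mul0r subr0.
  have ig : mu.-integrable (@I01 R) (EFin \o (fun x => g x * (q x - q x'))).
    apply: eq_integrable (integrableB mI (iq g cg) (integrableZr mI (q x') (ic g cg))) => //.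
    by move=> x _; rewrite /= mulrBr.
  apply: le_trans (le_normr_Rintegral mI ig) _.
  have -> : K * q x' = \int[mu]_(x in @I01 R) (K * q x').
    by rewrite Rintegral_cst// I01_fin mulr1.
  apply: le_Rintegral => //.
    exact: integrable_abse ig.
  move=> x xI; rewrite normrM (_ : K * q x' = k * ((expR alpha - 1) * q x')).
    by rewrite ler_pM// ?gk ?qq.
  by rewrite /K; ring.
(* The bound [Jle] holds at every point of [0, 1]; averaging it against the density [f] turns q(x')
   into [QPf Q f A]. *)
have -> : J = \int[mu]_(x in @I01 R) (J * f x).
  by rewrite RintegralZl//; [rewrite /Rintegral f1 mulr1|exact: ic].
rewrite -RintegralZl//; last exact: iq.
apply: le_Rintegral => //.
- exact: integrableZl (ic f cf).
- exact: integrableZl (iq f cf).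
- by move=> x xI; rewrite mulrCA mulrC ler_wpM2l ?f0// Jle.
Qed.

End private_channel.

Lemma cont_linear (R : realType) (w1 w2 : R -> R) (a b : R) :
  {within `[0%R, 1%R], continuous w1} -> {within `[0%R, 1%R], continuous w2} ->
  {within `[0%R, 1%R], continuous (fun x => a * w1 x + b * w2 x)}.
Proof.
move=> c1 c2 x; apply: cvgD.
  by apply: cvgM; [exact: cvg_cst|exact: c1].
by apply: cvgM; [exact: cvg_cst|exact: c2].
Qed.

(* The densities w true/false = f0 +- (f1 - f0) / e need not be nonnegative, but by local privacy their images under Q are probabilities; the laws of Z under f1 and f0 are then the images of the coins of bias e and 0 under the same channel. *)
Lemma private_two_point (R : realType) d (Z : measurableType d)
    (Q : R.-pker (measurableTypeR R) ~> Z) (alpha k : R) (n : nat) (f0 f1 : R -> R)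
    (P0 P1 : probability (n.-tuple Z) R) (est : n.-tuple Z -> R) (L0 L1 : R) :
  0 < alpha -> LDP alpha Q ->
  {within `[0%R, 1%R], continuous f0} -> {within `[0%R, 1%R], continuous f1} ->
  (forall x, x \in `[0, 1] -> 0 <= f0 x) ->
  (\int[@lebesgue_measure R]_(x in @I01 R) (f0 x)%:E = 1)%E ->
  (\int[@lebesgue_measure R]_(x in @I01 R) (f1 x)%:E = 1)%E ->
  (forall x, x \in `[0, 1] -> `|f1 x - f0 x| <= k) ->
  0 < k -> (0 < n)%N -> n%:R * ((expR alpha - 1) * k) ^+ 2 <= 8^-1 ->
  is_nfold_product P0 (QPf Q f0) -> is_nfold_product P1 (QPf Q f1) ->
  measurable_fun [set: n.-tuple Z] est ->
  ((`|L1 - L0| / 8)%:E <= \int[P1]_t (`|est t - L1|)%:E)%E \/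
  ((`|L1 - L0| / 8)%:E <= \int[P0]_t (`|est t - L0|)%:E)%E.
Proof.
move=> a0 ldp c0 c1 f0_ge0 f0_1 f1_1 fk k0 n0 nk P0E P1E mest.
set e := (expR alpha - 1) * k in nk *.
have e0 : 0 < e by rewrite mulr_gt0// subr_gt0 expR_gt1.
(* From n >= 1 and n e^2 <= 1/8. *)
have e1 : e <= 1.
  have n1 : 1 <= n%:R :> R by rewrite ler1n.
  nra.
pose g x := 1 * f1 x + (-1) * f0 x.
have cg : {within `[0%R, 1%R], continuous g} by exact: cont_linear.
have int_linear (w1 w2 : R -> R) (a b : R) : {within `[0%R, 1%R], continuous w1} ->
    {within `[0%R, 1%R], continuous w2} ->
    (\int[@lebesgue_measure R]_(x in @I01 R) (a * w1 x + b * w2 x)%:E =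
     a%:E * \int[@lebesgue_measure R]_(x in @I01 R) (w1 x)%:E +
     b%:E * \int[@lebesgue_measure R]_(x in @I01 R) (w2 x)%:E)%E.
  (* The integral of a function is the total mass of its image under [Q], so linearity is inherited
     from [QPf_linear]. *)
  move=> cw1 cw2; rewrite -!(QPf_setT _ _ _ Q); exact: QPf_linear.
have g_0 : (\int[@lebesgue_measure R]_(x in @I01 R) (g x)%:E = 0)%E.
  by rewrite int_linear// f0_1 f1_1 -!EFinM -EFinD; congr EFin; ring.
have gk x : x \in `[0, 1] -> `|g x| <= k.
  by move=> /fk; rewrite /g mul1r mulN1r.
have contr A (mA : measurable A) := LDP_contraction _ _ _ Q _ _ _ _ _ ldp a0 mA c0 cg f0_ge0 f0_1 g_0 gk.
pose w (b : bool) x := 1 * f0 x + (if b then e^-1 else - e^-1) * g x.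
have cw b : {within `[0%R, 1%R], continuous (w b)} by exact: cont_linear.
have w_1 b : (\int[@lebesgue_measure R]_(x in @I01 R) (w b x)%:E = 1)%E.
  by rewrite int_linear// f0_1 g_0 mule0 adde0 mule1.
have w_ge0 b A : measurable A -> (0 <= QPf Q (w b) A)%E.
  move=> mA; rewrite QPf_linear//; have := contr A mA.
  rewrite -(fineK (QPf_fin_num _ _ _ Q _ A mA c0)) -(fineK (QPf_fin_num _ _ _ Q _ A mA cg)).
  rewrite -!EFinM -EFinD !lee_fin -/e -ler_pdivrMl// => h.
  have := ler_norm (- (fine (QPf Q g A))); rewrite normrN.
  have := ler_norm (fine (QPf Q g A)).
  have ei0 : 0 < e^-1 by rewrite invr_gt0.
  case: b; nra.
have [nu nuE] := choice (fun b => QPf_probability _ _ _ Q (w b) (cw b) (w_1 b) (w_ge0 b)).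
have mixE (a : R) (f : R -> R) : f = (fun x => coin a true * w true x + coin a false * w false x) ->
    forall P : probability (n.-tuple Z) R, is_nfold_product P (QPf Q f) ->
    forall A : 'I_n -> set Z, (forall i, measurable (A i)) ->
    P (rect A) = (\prod_(i < n) ((coin a true)%:E * nu true (A i) +
                                 (coin a false)%:E * nu false (A i)))%E.
  move=> -> P PE A mA; rewrite [LHS]PE//; apply: eq_bigr => i _.
  by rewrite QPf_linear// !nuE.
have en0 : e != 0 by rewrite gt_eqF.
apply: (two_point_lower_bound _ _ _ P1 P0 est L1 L0 mest).
apply: (product_tv _ _ _ nu n e) => //.
- by rewrite ger0_norm// ltW.
- apply: mixE P1E; apply/funext => x; rewrite /coin /w /g; field.
  by rewrite en0.
- apply: mixE P0E; apply/funext => x; rewrite /coin /w /g; field.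
  by rewrite en0.
Qed.

(** * Smooth functions and norms *)

Section smooth_functions.
Context (R : realType).
Implicit Types (f g : R -> R) (p j m : nat).

Local Notation derivable_upto p f := (forall j : nat, (j < p)%N ->
  forall x : R, x \in `]0%R, 1%R[ -> derivable (derive1n j f) x 1).

(** The induction hypothesis is available on the open interval only; this suffices, since a
    derivative at x depends only on values near x. *)
Lemma derive1n_linear p f g (a b : R) : derivable_upto p f -> derivable_upto p g ->
  forall j : nat, (j <= p)%N -> forall x : R, x \in `]0%R, 1%R[ ->
  derive1n j (fun x => a * f x + b * g x) x = a * derive1n j f x + b * derive1n j g x.
Proof.
move=> df dg; elim=> [//|j IH] jp x x01.
rewrite !derive1nS !derive1E.
have fx := derivableP (df j jp x x01); have gx := derivableP (dg j jp x x01).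
have lin := is_deriveD (is_deriveZ a fx) (is_deriveZ b gx).
apply: derive_val.
apply: near_eq_is_derive lin.
have : \forall y \near x, y \in `]0%R, 1%R[.
  exact: near_in_itvoo.
by apply: filterS => y y01; rewrite IH// ltnW.
Qed.

Lemma derivable_upto_linear p f g (a b : R) : derivable_upto p f -> derivable_upto p g ->
  derivable_upto p (fun x => a * f x + b * g x).
Proof.
move=> df dg j jp x x01.
have fx := derivableP (df j jp x x01); have gx := derivableP (dg j jp x x01).
have lin := is_deriveD (is_deriveZ a fx) (is_deriveZ b gx).
apply: (@ex_derive _ _ _ _ _ _ (a *: 'D_1 (derive1n j f) x + b *: 'D_1 (derive1n j g) x)).
apply: near_eq_is_derive lin.
have : \forall y \near x, y \in `]0%R, 1%R[.
  exact: near_in_itvoo.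
by apply: filterS => y y01; rewrite (derive1n_linear p)// ltnW.
Qed.

Lemma Cp_linear p f g (a b : R) : Cp p f -> Cp p g -> Cp p (fun x => a * f x + b * g x).
Proof.
move=> [cf [df ef]] [cg [dg eg]]; split; first exact: cont_linear.
split; first exact: derivable_upto_linear.
move=> j jp; have [F [cF FE]] := ef j jp; have [G [cG GE]] := eg j jp.
exists (fun x => a * F x + b * G x); split; first exact: cont_linear.
by move=> x x01; rewrite (derive1n_linear p)// FE// GE.
Qed.

Lemma cont_bounded f : {within `[0%R, 1%R], continuous f} ->
  exists2 B : R, 0 < B & forall x, x \in `[0, 1] -> `|f x| <= B.
Proof.
move=> cf; have [c _ fc] := EVT_max ler01 cf; have [c' _ fc'] := EVT_min ler01 cf.
exists (1 + `|f c| + `|f c'|); first by rewrite ltr_pwDl// addr_ge0.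
move=> x x01; have := fc x x01; have := fc' x x01.
have := ler_norm (f c); have := ler_norm (- f c'); rewrite normrN.
have := normr_ge0 (f c); have := normr_ge0 (f c').
by rewrite ler_norml => *; apply/andP; split; lra.
Qed.

(** Each derivative agrees on ]0, 1[ with a continuous function on a compact interval; summing the
    bounds gives one constant for all orders. *)
Lemma derive1n_bounded p f : Cp p f ->
  exists2 B : R, 0 < B & forall j : nat, (j <= p)%N ->
    forall x, x \in `]0, 1[ -> `|derive1n j f x| <= B.
Proof.
move=> [_ [_ ef]].
have bnd (j : 'I_p.+1) : exists B, 0 < B /\ forall x, x \in `]0, 1[ -> `|derive1n j f x| <= B.
  have [g [cg gE]] := ef j (ltn_ord j); have [B B0 gB] := cont_bounded g cg.
  by exists B; split=> // x x01; rewrite -gE// gB// (subset_itv_oo_cc x01).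
have [B BP] := choice bnd.
have sB0 (P : pred 'I_p.+1) : 0 <= \sum_(i | P i) B i.
  by apply: sumr_ge0 => i _; rewrite ltW// (BP i).1.
exists (\sum_i B i).
  by rewrite (bigD1 ord0)//= ltr_pwDl// (BP ord0).1.
move=> j jp x x01; pose i : 'I_p.+1 := Ordinal (jp : (j < p.+1)%N).
by apply: le_trans ((BP i).2 x x01) _; rewrite (bigD1 i)//= lerDl.
Qed.

(** At the endpoints [Dj] is a [lim], meaningful only once convergence is known; the continuous
    extension supplies it, and bounds pass to the limit. *)
Lemma Dj_bounded p f j (B : R) : Cp p f -> (j <= p)%N ->
  (forall x, x \in `]0, 1[ -> `|derive1n j f x| <= B) ->
  forall x, x \in `[0, 1] -> `|Dj j f x| <= B.
Proof.
move=> [_ [_ ef]] jp fB x x01; rewrite /Dj.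
have [g [cg gE]] := ef j jp.
have [_ g0 g1] := (continuous_within_itvP _ ltr01).1 cg.
case: eqP => [_|/eqP x0].
  have near0 : \forall y \near (0 : R)^'+, y \in `]0%R, 1%R[.
    by apply: filterS2 (nbhs_right_gt (0 : R)) (nbhs_right_lt (@ltr01 R)) => y y0 y1; rewrite in_itv/= y0 y1.
  have cvg0 : cvg (derive1n j f y @[y --> 0^'+]).
    apply: (cvgP (g 0)); apply: cvg_trans g0; apply: near_eq_cvg.
    by apply: filterS near0 => y y01; rewrite gE.
  rewrite ler_norml; apply/andP; split.
    apply: (limr_ge cvg0); apply: filterS near0 => y /fB.
    by rewrite ler_norml => /andP[].
  apply: (limr_le cvg0); apply: filterS near0 => y /fB.
  by rewrite ler_norml => /andP[].
case: eqP => [_|/eqP x1].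
  have near1 : \forall y \near (1 : R)^'-, y \in `]0%R, 1%R[.
    by apply: filterS2 (nbhs_left_lt (1 : R)) (nbhs_left_gt (@ltr01 R)) => y y1 y0; rewrite in_itv/= y0 y1.
  have cvg1 : cvg (derive1n j f y @[y --> 1^'-]).
    apply: (cvgP (g 1)); apply: cvg_trans g1; apply: near_eq_cvg.
    by apply: filterS near1 => y y01; rewrite gE.
  rewrite ler_norml; apply/andP; split.
    apply: (limr_ge cvg1); apply: filterS near1 => y /fB.
    by rewrite ler_norml => /andP[].
  apply: (limr_le cvg1); apply: filterS near1 => y /fB.
  by rewrite ler_norml => /andP[].
apply: fB; move: x01; rewrite !in_itv/= => /andP[xge0 xle1].
by rewrite !lt_neqAle eq_sym x0 x1 xge0 xle1.
Qed.

(** [B] does not depend on [s]: linearity of this bound in |s| makes the squared seminorm in the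
    remainder O(s^2). *)
Lemma Cp_scale_Dj_bound p f : Cp p f ->
  exists2 B : R, 0 < B & forall (s : R) (j : nat), (j <= p)%N ->
    forall x, x \in `[0, 1] -> `|Dj j (fun x => s * f x) x| <= `|s| * B.
Proof.
move=> Cf; have [B B0 fB] := derive1n_bounded p f Cf.
exists B => // s j jp.
have sE : (fun x => s * f x) = (fun x => s * f x + 0 * f x).
  by apply/funext => x; rewrite mul0r addr0.
apply: (Dj_bounded p) => //; first by rewrite sE; exact: Cp_linear.
move=> x x01; have [_ [df _]] := Cf.
by rewrite sE (derive1n_linear p)// mul0r addr0 normrM ler_wpM2l// fB.
Qed.

End smooth_functions.

(** * Seminorms for measures restricted to the unit interval *)

Section integral_mrestr.
Import HBNNSimple.

(* No measurability is required of f: off D it is arbitrary, and simple functions below f are bounded by c on D. *)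
Lemma ge0_integral_mrestr_le d (T : measurableType d) (R : realType)
    (mu : {measure set T -> \bar R}) (D : set T) (mD : measurable D)
    (f : T -> \bar R) (c : R) : (forall x, 0 <= f x)%E -> 0 <= c ->
  (forall x, D x -> f x <= c%:E)%E ->
  (\int[mrestr mu mD]_x f x <= c%:E * mu D)%E.
Proof.
move=> f0 c0 fc; rewrite ge0_integralTE//; apply: ge_ereal_sup => _ [h /= hf <-].
rewrite -integralT_nnsfun.
have -> : mu D = mrestr mu mD setT by rewrite /mrestr setTI.
rewrite -integral_cst//.
have mh : measurable_fun setT (fun x => (h x)%:E) by apply/measurable_EFinP.
apply: ae_ge0_le_integral => //.
  by move=> x _; rewrite lee_fin.
exists (~` D); split; first exact: measurableC.
  by rewrite /= /mrestr setICl measure0.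
move=> x /= hx Dx; apply: hx => _; exact: le_trans (hf x) (fc x Dx).
Qed.

End integral_mrestr.

Section norm_bounds.
Context (R : realType).
Local Notation RT := (measurableTypeR R).

(** For a mass L the natural factor is the square root of L; L + 1 dominates it, since L <= (L +
    1)^2, and avoids the root. *)
Lemma Lnorm2_mrestr_le (lam : {finite_measure set RT -> \bar R}) (F : RT -> R) (B : R) :
  0 <= B -> (forall x, x \in `[0, 1] -> `|F x| <= B) ->
  (Lnorm (mrestr lam (@measurable_I01 R)) 2%:E (EFin \o F) <=
    (B * (fine (lam (@I01 R)) + 1))%:E)%E.
Proof.
move=> B0 FB; rewrite unlock.
have lfin : lam (@I01 R) \is a fin_num by apply: fin_num_measure; exact: measurable_I01.
have L0 : 0 <= fine (lam (@I01 R)) by exact: fine_ge0.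
set L := fine _ in L0 *.
have int_le : (\int[mrestr lam (@measurable_I01 R)]_x (`|(EFin \o F) x| `^ 2) <=
    ((B * (L + 1)) ^+ 2)%:E)%E.
  apply: le_trans (ge0_integral_mrestr_le _ _ _ lam _ (@measurable_I01 R) _ (B ^+ 2) _ _ _) _.
  - by move=> x; exact: poweR_ge0.
  - exact: sqr_ge0.
  - move=> x xI; rewrite -[abse _]/(`|F x|%:E) poweR_EFin lee_fin powR_mulrn// lerXn2r ?nnegrE//.
    exact: FB.
  change ((B ^+ 2)%:E * lam (@I01 R) <= ((B * (L + 1)) ^+ 2)%:E)%E.
  by rewrite -(fineK lfin) -EFinM lee_fin -/L exprMn ler_wpM2l ?sqr_ge0//; nra.
have BL0 : 0 <= B * (L + 1) by rewrite mulr_ge0// addr_ge0.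
apply: (@le_trans _ _ ((((B * (L + 1)) ^+ 2)%:E) `^ 2^-1)%E).
  apply: gt0_ler_poweR => //; rewrite ?in_itv/= ?leey ?andbT ?lee_fin ?sqr_ge0//.
  by apply: integral_ge0 => x _; rewrite lee_fin powR_ge0.
by rewrite poweR_EFin -powR_mulrn// -powRrM mulfV// powRr1.
Qed.

Lemma normqp2_le (lam : nat -> {finite_measure set RT -> \bar R}) (m : nat)
    (f : RT -> R) (B : R) : 0 <= B ->
  (forall j x, (j <= m)%N -> x \in `[0, 1] -> `|Dj j f x| <= B) ->
  (normqp (fun j => lam j) 2%:E m f <=
    (B * \sum_(j < m.+1) (fine (lam j (@I01 R)) + 1))%:E)%E.
Proof.
move=> B0 fB; rewrite /normqp mulr_sumr -sumEFin; apply: lee_sum => j _.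
by apply: Lnorm2_mrestr_le => // x; apply: fB; rewrite -ltnS.
Qed.

Lemma normLeb_oo_le (m : nat) (f : RT -> R) (B : R) : 0 <= B ->
  (forall j x, (j <= m)%N -> x \in `[0, 1] -> `|Dj j f x| <= B) ->
  (normLeb +oo%E m f <= (m.+1%:R * B)%:E)%E.
Proof.
move=> B0 fB; rewrite /normLeb /normqp.
apply: (@le_trans _ _ (\sum_(j < m.+1) B%:E)%E); last first.
  by rewrite sumEFin sumr_const card_ord mulr_natl.
apply: lee_sum => j _; rewrite unlock; case: ifP => // _.
apply/ess_supP; exists (~` (@I01 R)); split.
- by apply: measurableC; exact: measurable_I01.
- by rewrite /= /mrestr setICl measure0.
- move=> x /= hx xI; apply: hx; rewrite lee_fin; apply: fB => //.
  by rewrite -ltnS.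
Qed.

(** The expansion makes [D] the derivative of [phi] inside the interval. By the mean value theorem D
    t is nonzero at some interior t, and near t the linear term is at least twice the remainder. *)
Lemma quadratic_expansion_separates (phi D : R -> R) :
  (forall t, t \in `[0, 1] -> exists K e : R, 0 < e /\
    forall s, `|s| < e -> t + s \in `[0, 1] ->
    `|phi (t + s) - phi t - s * D t| <= K * s ^+ 2) ->
  phi 0 <> phi 1 ->
  exists t s0 a : R, [/\ t \in `[0, 1], 0 < s0, 0 < a &
    forall s, 0 < s -> s <= s0 ->
      t + s \in `[0, 1] /\ a * s <= `|phi (t + s) - phi t|].
Proof.
move=> expan phi01.
(* This serves the endpoints, where only one-sided continuity of [phi] is needed. *)
have lip t : t \in `[0, 1] -> exists L e : R, [/\ 0 < L, 0 < e &
    forall s, `|s| < e -> t + s \in `[0, 1] -> `|phi (t + s) - phi t| <= L * `|s|].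
  move=> t01; have [K [e [e0 H]]] := expan t t01.
  exists (`|K| * e + `|D t| + 1), e; split=> //.
    by rewrite ltr_wpDl// addr_ge0// mulr_ge0// ltW.
  move=> s se ts; have := H s se ts => h.
  have -> : phi (t + s) - phi t = (phi (t + s) - phi t - s * D t) + s * D t by ring.
  apply: le_trans (ler_normD _ _) _; rewrite normrM.
  have s2 : s ^+ 2 = `|s| ^+ 2 by rewrite real_normK// num_real.
  have := normr_ge0 s; have := ler_norm K; have := normr_ge0 K; have := normr_ge0 (D t).
  have Ks : K * `|s| ^+ 2 <= `|K| * e * `|s|.
    rewrite expr2 mulrA ler_wpM2r//; apply: (@le_trans _ _ (`|K| * `|s|)).
      by rewrite ler_wpM2r// ler_norm.
    by rewrite ler_wpM2l// ltW.
  by rewrite s2 in h; move=> *; rewrite !mulrDl; lra.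
have der (x : R) : x \in `]0, 1[ -> is_derive x 1 phi (D x).
  move=> x01; have x01' := subset_itv_oo_cc x01.
  have [K [e [e0 H]]] := expan x x01'.
  have cvgD : h^-1 *: ((phi \o shift x) (h *: 1) - phi x) @[h --> 0^'] --> D x.
    apply/cvgrPdist_le => r r0.
    near=> h.
    have h0 : h != 0 by near: h; exact: nbhs_dnbhs_neq.
    have he : `|h| < e by near: h; apply: dnbhs0_lt.
    have hK : `|h| < r / (`|K| + 1).
      by near: h; apply: dnbhs0_lt; rewrite divr_gt0// ltr_wpDl.
    have hx : `|h| < Num.min x (1 - x).
      near: h; apply: dnbhs0_lt; move: x01; rewrite in_itv/= => /andP[x0 x1].
      by rewrite lt_min x0 subr_gt0.
    have xh : x + h \in `[0, 1].
      move: hx; rewrite lt_min !ltr_norml in_itv/= => /andP[/andP[? ?] /andP[? ?]].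
      by apply/andP; split; lra.
    have := H h he xh => Hh.
    rewrite /= [h *: 1]mulr1 (addrC h).
    have -> : D x - h^-1 *: (phi (x + h) - phi x) =
        - (h^-1 * (phi (x + h) - phi x - h * D x)).
      by rewrite /GRing.scale/=; field.
    rewrite normrN normrM normfV ler_pdivrMl ?normr_gt0//.
    apply: le_trans Hh _.
    have -> : h ^+ 2 = `|h| ^+ 2 by rewrite real_normK// num_real.
    rewrite expr2 mulrCA ler_wpM2l//.
    have K0 : 0 < `|K| + 1 by rewrite ltr_wpDl.
    rewrite ltr_pdivlMr// in hK.
    have := ler_norm K; have := normr_ge0 h; nra.
  by apply: DeriveDef; [exact: cvgP cvgD|exact: cvg_lim cvgD].
have cphi : {within `[0%R, 1%R], continuous phi}.
  apply/continuous_within_itvP => //; split.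
  - move=> x x01; apply: differentiable_continuous; apply/derivable1_diffP.
    exact: (@ex_derive _ _ _ _ _ _ _ (der x x01)).
  - have [|L [e [L0 e0 H]]] := lip 0; first by rewrite in_itv/= lexx ler01.
    apply/cvgrPdist_le => r r0; near=> y.
    have y0 : 0 < y by near: y; exact: nbhs_right_gt.
    have ye : y < e by near: y; exact: nbhs_right_lt.
    have yr : y < r / L by near: y; apply: nbhs_right_lt; rewrite divr_gt0.
    have y1 : y < 1 by near: y; exact: nbhs_right_lt.
    have := H y; rewrite add0r gtr0_norm// distrC => /(_ ye).
    rewrite in_itv/= (ltW y0) (ltW y1) => /(_ isT) /le_trans; apply.
    by rewrite mulrC -ler_pdivlMr// ltW.
  - have [|L [e [L0 e0 H]]] := lip 1; first by rewrite in_itv/= lexx ler01.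
    apply/cvgrPdist_le => r r0; near=> y.
    have y1 : y < 1 by near: y; exact: nbhs_left_lt.
    have ye : 1 - e < y by near: y; apply: nbhs_left_gt; lra.
    have yr : 1 - r / L < y.
      by near: y; apply: nbhs_left_gt; rewrite gtrBl divr_gt0.
    have y0 : 0 < y by near: y; exact: nbhs_left_gt.
    have ny : `|y - 1| = 1 - y by rewrite ltr0_norm ?opprB// subr_lt0.
    have := H (y - 1); rewrite ny subrKC distrC => /(_ _ _)/le_trans; apply.
    - by lra.
    - by rewrite in_itv/= (ltW y0) (ltW y1).
    - by rewrite mulrC -ler_pdivlMr//; lra.
have [t t01 phiE] := MVT ltr01 der cphi.
have Dt0 : D t != 0.
  by apply/eqP => Dt0; apply: phi01; apply/esym/eqP; rewrite -subr_eq0 phiE Dt0 mul0r.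
have [K [e [e0 H]]] := expan t (subset_itv_oo_cc t01).
have a0 : 0 < `|D t| / 2 by rewrite divr_gt0// normr_gt0.
have t1 : 0 < 1 - t by move: t01; rewrite in_itv/= => /andP[_]; rewrite subr_gt0.
have K0 : 0 < `|K| + 1 by rewrite ltr_wpDl.
(* The three bounds keep s < e, keep t + s <= 1, and make K s^2 at most s |D t| / 2; the added 1
   prevents division by zero. *)
exists t, (Num.min (Num.min (e / 2) (1 - t)) (`|D t| / 2 / (`|K| + 1))), (`|D t| / 2).
split=> //; first exact: subset_itv_oo_cc t01.
  by rewrite !lt_min t1 !divr_gt0 ?normr_gt0.
move=> s s0; rewrite !le_min => /andP[/andP[se st] sK].
have ts : t + s \in `[0, 1].
  move: t01; rewrite !in_itv/= => /andP[tp _]; apply/andP; split; lra.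
split=> //.
have se' : `|s| < e by rewrite gtr0_norm//; lra.
have := H s se' ts => Hs.
rewrite ler_pdivlMr// in sK.
have : s * `|D t| <= `|phi (t + s) - phi t| + `|phi (t + s) - phi t - s * D t|.
  rewrite -{1}(gtr0_norm s0) -normrM -[in X in _ + X]normrN.
  apply: le_trans (ler_normD _ _); rewrite le_eqVlt; apply/orP; left.
  by apply/eqP; congr `|_|; ring.
have := ler_norm K; nra.
Unshelve. all: by end_near. Qed.

End norm_bounds.

(** * The functional along a segment *)

Lemma normqp_ge0 (R : realType) (lam : nat -> {measure set (measurableTypeR R) -> \bar R})
    (q : \bar R) (m : nat) (f : measurableTypeR R -> R) : (0 <= normqp lam q m f)%E.
Proof. by apply: sume_ge0 => j _; exact: Lnorm_ge0. Qed.

Section path.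
Context (R : realType).

(** Written with explicit coefficients to match [Cp_linear] and [cont_linear]. *)
Definition path_dir (f g : R -> R) (x : R) : R := 1 * g x + (-1) * f x.
Definition path_at (f g : R -> R) (t x : R) : R := 1 * f x + t * path_dir f g x.

Lemma path_at_convex (W : set (R -> R)) (f g : R -> R) (t : R) :
  convex_fset W -> W f -> W g -> t \in `[0, 1] -> W (path_at f g t).
Proof.
move=> cW Wf Wg t01; have -> : path_at f g t = (fun x => t * g x + (1 - t) * f x).
  by apply/funext => x; rewrite /path_at /path_dir; ring.
by apply: cW => //; move: t01; rewrite in_itv.
Qed.

(** The increment s h has linear term s T(h), with T taken at the base point of parameter t, and its
    squared seminorm is O(s^2). Hence D t = T(h). *)
Lemma differentiable_along_path (p m : nat) (W : set (R -> R)) (Lam : (R -> R) -> R)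
    (f g : R -> R) :
  convex_fset W -> (forall f, W f -> Cp p f) -> differentiable_functional p W Lam m ->
  W f -> W g ->
  exists D : R -> R, forall t, t \in `[0, 1] -> exists K e : R, 0 < e /\
    forall s, `|s| < e -> t + s \in `[0, 1] ->
    `|Lam (path_at f g (t + s)) - Lam (path_at f g t) - s * D t| <= K * s ^+ 2.
Proof.
move=> cW WC [mp [lam dLam]] Wf Wg; set h := path_dir f g.
have Ch : Cp p h by apply: Cp_linear; exact: WC.
have [B B0 hB] := Cp_scale_Dj_bound R p h Ch.
suff /choice[D HD] : forall t, exists D : R, t \in `[0, 1] -> exists K e : R, 0 < e /\
    forall s, `|s| < e -> t + s \in `[0, 1] ->
    `|Lam (path_at f g (t + s)) - Lam (path_at f g t) - s * D| <= K * s ^+ 2.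
  by exists D.
(* Choice needs a value at every real t; 0 is a dummy value off [0, 1]. *)
move=> t; have [t01|] := boolP (t \in `[0, 1]); last by exists 0.
have [T [Tlin [_ [K [delta [delta0 H]]]]]] := dLam _ (path_at_convex _ _ _ _ cW Wf Wg t01).
exists (T h) => _.
pose S : R := \sum_(j < m.+1) (fine (lam j (@I01 R)) + 1).
(* [K] may be negative, hence |K|. The radius makes (m + 1) |s| B, which bounds the sup norm of
   order m of s h, smaller than [delta]. *)
exists (`|K| * (B * S) ^+ 2), (delta / (m.+1%:R * B)); split.
  by rewrite divr_gt0// mulr_gt0.
move=> s; rewrite ltr_pdivlMr ?mulr_gt0// => sdelta ts.
pose hs x := s * h x.
(* The null term puts [hs] in the two-term form of [Tlin] and [Cp_linear]. *)
have hsE : hs = (fun x => s * h x + 0 * h x).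
  by apply/funext => x; rewrite mul0r addr0.
have Chs : Cp p hs by rewrite hsE; exact: Cp_linear.
have pathE : path_at f g (t + s) = (fun x => path_at f g t x + hs x).
  by apply/funext => x; rewrite /path_at /hs /h; ring.
have Whs : W (fun x => path_at f g t x + hs x) by rewrite -pathE; exact: path_at_convex.
have sB0 : 0 <= `|s| * B by rewrite mulr_ge0// ltW.
have hsB j x : (j <= m)%N -> x \in `[0, 1] -> `|Dj j hs x| <= `|s| * B.
  by move=> jm; apply: hB; exact: leq_trans jm (ltnW mp).
have small : (normLeb +oo%E m hs < delta%:E)%E.
  apply: le_lt_trans (normLeb_oo_le _ m hs _ sB0 hsB) _.
  by rewrite lte_fin mulrCA.
have := H hs Chs Whs small.
rewrite -pathE hsE Tlin// mul0r addr0 -hsE => Hs; rewrite -lee_fin.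
apply: le_trans Hs _.
have S_le := normqp2_le _ lam m hs _ sB0 hsB.
set N := normqp _ _ _ _ in S_le *.
have N0 : (0 <= N)%E by exact: normqp_ge0.
apply: (@le_trans _ _ (`|K|%:E * (N * N))%E).
  by rewrite lee_wpmul2r ?mule_ge0// lee_fin ler_norm.
have -> : (`|K| * (B * S) ^+ 2 * s ^+ 2)%:E =
    (`|K|%:E * ((`|s| * B * S)%:E * (`|s| * B * S)%:E))%E.
  rewrite -!EFinM; congr EFin.
  have -> : s ^+ 2 = `|s| ^+ 2 by rewrite real_normK// num_real.
  by ring.
by rewrite lee_wpmul2l ?lee_fin// lee_pmul.
Qed.

End path.

(** * Choice of the two densities and of the constants *)

Theorem mainTheorem1 (R : realType) (M : R) (p : nat) (W : set (R -> R))
    (Lam : (R -> R) -> R) (m : nat) :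
  0 < M ->
  convex_fset W ->
  W `<=` Wp M p ->
  differentiable_functional p W Lam m ->
  (exists f g, W f /\ W g /\ Lam f <> Lam g) ->
  exists c C : R, 0 < c /\ 0 < C /\
  forall (n : nat) (alpha : R), 0 < alpha ->
    C <= n%:R * (expR alpha - 1) ^+ 2 ->
    forall (d : measure_display) (Z : measurableType d) (Q : R.-pker (measurableTypeR R) ~> Z),
      LDP alpha Q ->
      forall Pn : (R -> R) -> probability (n.-tuple Z) R,
        (forall f, W f -> is_nfold_product (Pn f) (QPf Q f)) ->
      forall est : n.-tuple Z -> R, measurable_fun [set: n.-tuple Z] est ->
        ((c / Num.sqrt (n%:R * (expR alpha - 1) ^+ 2))%:E <=
         ereal_sup [set (\int[Pn f]_t (`|est t - Lam f|)%:E)%E | f in W])%E.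
Proof.
move=> M0 cW WWp dLam [f [g [Wf [Wg Lfg]]]].
have WC u : W u -> Cp p u by move=> /WWp[].
have [D expan] := differentiable_along_path R p m W Lam f g cW WC dLam Wf Wg.
have path0 : path_at R f g 0 = f.
  by apply/funext => x; rewrite /path_at mul0r addr0 mul1r.
have path1 : path_at R f g 1 = g.
  by apply/funext => x; rewrite /path_at /path_dir; ring.
have [|t [s0 [a [t01 s00 a0 sep]]]] :=
  quadratic_expansion_separates R (fun t => Lam (path_at R f g t)) D expan.
  by rewrite path0 path1.
have ch : {within `[0%R, 1%R], continuous (path_dir R f g)}.
  by apply: cont_linear; [case: (WC g Wg)|case: (WC f Wf)].
have [B B0 hB] := cont_bounded R _ ch.
(* With s = c1 / sqrt N, this makes n ((e^alpha - 1) s B)^2 equal to 1/9, within the allowed 1/8. *)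
pose c1 : R := (3 * B)^-1.
have c10 : 0 < c1 by rewrite invr_gt0 mulr_gt0.
(* The first constant combines the separation a s with the factor 1/8 of the two-point bound; the
   second ensures s <= s0. *)
exists (a * c1 / 8), ((c1 / s0) ^+ 2); split; first by rewrite !mulr_gt0.
split; first by rewrite exprn_gt0// divr_gt0.
move=> n alpha alpha0; set N := n%:R * _ => CN d Z Q ldp Pn PnE est mest.
have N0 : 0 < N by apply: lt_le_trans CN; rewrite exprn_gt0// divr_gt0.
have n0 : (0 < n)%N.
  by rewrite lt0n; apply: contraTneq N0 => n_0; rewrite /N n_0 mul0r ltxx.
have sN0 : 0 < Num.sqrt N by rewrite sqrtr_gt0.
pose s := c1 / Num.sqrt N.
have s_gt0 : 0 < s by rewrite divr_gt0.
have ss0 : s <= s0.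
  rewrite ler_pdivrMr// mulrC -ler_pdivrMr//.
  have := ler_wsqrtr CN; rewrite sqrtr_sqr ger0_norm// ltW// divr_gt0//.
have [ts01 sep_s] := sep s s_gt0 ss0.
set u0 := path_at R f g t in sep_s *; set u1 := path_at R f g (t + s) in sep_s *.
have Wu0 : W u0 by exact: path_at_convex.
have Wu1 : W u1 by exact: path_at_convex.
have [Cu0 u0_ge0 u0_1 _] := WWp _ Wu0; have [Cu1 _ u1_1 _] := WWp _ Wu1.
have u01 x : x \in `[0, 1] -> `|u1 x - u0 x| <= s * B.
  move=> x01; have -> : u1 x - u0 x = s * path_dir R f g x.
    by rewrite /u1 /u0 /path_at; ring.
  by rewrite normrM gtr0_norm// ler_wpM2l ?hB// ltW.
have budget : n%:R * ((expR alpha - 1) * (s * B)) ^+ 2 <= 8^-1.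
  have -> : n%:R * ((expR alpha - 1) * (s * B)) ^+ 2 = 9^-1.
    have -> : n%:R * ((expR alpha - 1) * (s * B)) ^+ 2 =
        N * (c1 * B) ^+ 2 / Num.sqrt N ^+ 2.
      by rewrite /N /s; field; rewrite gt_eqF.
    rewrite sqr_sqrtr ?ltW// /c1; field.
    by rewrite !gt_eqF.
  by lra.
have lower : ((a * c1 / 8) / Num.sqrt N <= `|Lam u1 - Lam u0| / 8).
  have -> : a * c1 / 8 / Num.sqrt N = a * s / 8 by rewrite /s; field; rewrite gt_eqF.
  by rewrite ler_pM2r.
have [] := private_two_point R d Z Q alpha (s * B) n u0 u1 (Pn u0) (Pn u1) est
    (Lam u0) (Lam u1) alpha0 ldp Cu0.1 Cu1.1 u0_ge0 u0_1 u1_1 u01 (mulr_gt0 s_gt0 B0)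
    n0 budget (PnE _ Wu0) (PnE _ Wu1) mest => le_risk.
- apply: le_trans (ereal_sup_ubound _) => /=; last by exists u1.
  by apply: le_trans le_risk; rewrite lee_fin.
- apply: le_trans (ereal_sup_ubound _) => /=; last by exists u0.
  by apply: le_trans le_risk; rewrite lee_fin.
Qed.
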